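(* $(\mathcal{N},\sim_V)\models\forall\mathsf{x}\forall\mathsf{y}[\neg AP(\mathsf{x},\mathsf{y})]$; that is, for all $\alpha,\beta\in\mathcal{N}$ it is not the case that $\forall\gamma[\neg(\gamma\sim_V\alpha)\vee\neg(\gamma\sim_V\beta)]$.
   Context: Intuitionistic mathematics (constructive reading of logical constants; Markov's Principle not assumed), with Brouwer's Continuity Principle as an axiom (for every $R\subseteq\mathcal{N}\times\omega$, if $\forall\alpha\exists n[\alpha Rn]$ then $\forall\alpha\exists m\exists n\forall\beta[\overline{\alpha}m\sqsubset\beta\rightarrow\beta Rn]$, where $\overline{\alpha}m=\langle\alpha(0),\dots,\alpha(m-1)\rangle$ and $\sqsubset$ is ''initial segment of''). $\mathcal{N}=\omega^\omega$; $\alpha\sim_V\beta$ iff $\exists n\forall m>n[\alpha(m)=\beta(m)]$. $AP(\mathsf{x},\mathsf{y})$ is the formula $\forall\mathsf{z}[\neg(\mathsf{z}=\mathsf{x})\vee\neg(\mathsf{z}=\mathsf{y})]$, with $=$ interpreted by $\sim_V$; satisfaction read intuitionistically. *)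

(* Defs.v *)
From Stdlib Require Import Arith.

Definition Baire := nat -> nat.

Definition simV (alpha beta : Baire) : Prop :=
  exists n : nat, forall m : nat, n < m -> alpha m = beta m.

Definition extends_prefix (alpha : Baire) (m : nat) (beta : Baire) : Prop :=
  forall i : nat, i < m -> beta i = alpha i.

Definition BCP : Prop :=
  forall R : Baire -> nat -> Prop,
    (forall alpha : Baire, exists n : nat, R alpha n) ->
    forall alpha : Baire, exists m : nat, exists n : nat,
      forall beta : Baire, extends_prefix alpha m beta -> R beta n.

Definition AP (alpha beta : Baire) : Prop :=
  forall gamma : Baire, ~ simV gamma alpha \/ ~ simV gamma beta.

(* Main.v *)
Require Import Defs.
From Stdlib Require Import Arith Lia.

(* By the Continuity Principle, the choice between the two disjuncts of
   AP(alpha, beta) is already made on some neighbourhood of alpha.  The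
   neighbourhood contains alpha itself, which is ~_V alpha, and also the
   sequence that starts like alpha and continues like beta, which is
   ~_V beta; so neither disjunct can hold throughout it. *)

Lemma BCP_disjunction_locally_decided (P Q : Baire -> Prop) :
  BCP -> (forall gamma, P gamma \/ Q gamma) ->
  forall alpha, exists m,
    (forall beta, extends_prefix alpha m beta -> P beta) \/
    (forall beta, extends_prefix alpha m beta -> Q beta).
Proof.
  intros bcp PQ alpha.
  destruct (bcp (fun gamma n => if n =? 0 then P gamma else Q gamma))
    with (alpha := alpha) as [m [n Hn]].
  - intros gamma. destruct (PQ gamma) as [p | q].
    + now exists 0.
    + now exists 1.
  - exists m. destruct (n =? 0); [left | right]; exact Hn.
Qed.

Lemma simV_refl (alpha : Baire) : simV alpha alpha.
Proof. now exists 0. Qed.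

Definition splice (alpha : Baire) (m : nat) (beta : Baire) : Baire :=
  fun i => if i <? m then alpha i else beta i.

Lemma splice_extends_prefix (alpha beta : Baire) (m : nat) :
  extends_prefix alpha m (splice alpha m beta).
Proof.
  intros i Hi. unfold splice. now rewrite (proj2 (Nat.ltb_lt i m) Hi).
Qed.

Lemma splice_simV (alpha beta : Baire) (m : nat) :
  simV (splice alpha m beta) beta.
Proof.
  exists m. intros i Hi. unfold splice.
  now rewrite (proj2 (Nat.ltb_ge i m) (Nat.lt_le_incl _ _ Hi)).
Qed.

Theorem theorem9p3 :
  BCP -> forall alpha beta : Baire, ~ AP alpha beta.
Proof.
  intros bcp alpha beta ap.
  destruct (BCP_disjunction_locally_decided _ _ bcp ap alpha)
    as [m [notA | notB]].
  - exact (notA alpha (fun _ _ => eq_refl) (simV_refl alpha)).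
  - exact (notB _ (splice_extends_prefix alpha beta m) (splice_simV alpha beta m)).
Qed.
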